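(* Let $\mathbb{A}=\langle A;F\rangle$ be an independence algebra of finite dimension $n$, with $|A|\geq 2$. Then the largest subsemilattices of the monoid $\mathrm{End}(\mathbb{A})$ (that is, the subsemilattices of maximum cardinality) have either $2^{n-1}$ or $2^n$ elements, with the latter happening exactly when the clone of $\mathbb{A}$ contains constant operations.
   Context: An algebra $\mathbb{A}=\langle A;F\rangle$ consists of a nonempty set $A$ (the universe) and a set $F$ of finitary operations on $A$ (the fundamental operations); nullary operations are allowed, and a nullary operation $f()=a$ is identified with the element $a\in A$. An endomorphism of $\mathbb{A}$ is a map $\alpha:A\to A$ such that for every $k\ge 0$, every $k$-ary $f\in F$ and all $a_1,\dots,a_k\in A$, $\alpha(f(a_1,\dots,a_k))=f(\alpha(a_1),\dots,\alpha(a_k))$. $\mathrm{End}(\mathbb{A})$ is the monoid of endomorphisms under composition. The clone of $\mathbb{A}$ is the smallest set of operations on $A$ that contains $F$ and all projections $p^k_i(x_1,\dots,x_k)=x_i$ ($k\ge1$, $1\le i\le k$), and is closed under generalized composition; nullary operations are included in the clone. A $k$-ary operation $f$ on $A$ is a constant operation if there is $a\in A$ with $f(a_1,\dots,a_k)=a$ for all $a_1,\dots,a_k\in A$ (nullary operations are constant operations). For nonempty $X\subseteq A$, $\langle X\rangle$ is the subalgebra generated by $X$. If $\mathrm{Con}$ is the set of nullary operations in $F$, then $\langle\emptyset\rangle=\langle\mathrm{Con}\rangle$ if $\mathrm{Con}\neq\emptyset$, and $\langle\emptyset\rangle=\emptyset$ if $\mathrm{Con}=\emptyset$. A set $X\subseteq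 A$ is independent if $x\notin\langle X\setminus\{x\}\rangle$ for all $x\in X$. The exchange property is: for all $X\subseteq A$ and $x,y\in A$, if $x\in\langle X\cup\{y\}\rangle$ and $x\notin\langle X\rangle$, then $y\in\langle X\cup\{x\}\rangle$. In an algebra with the exchange property, a basis is an independent generating set; bases exist and all have the same cardinality, called the dimension of $\mathbb{A}$. $\mathbb{A}$ is an independence algebra if (1) it satisfies the exchange property, and (2) for any basis $X$ of $\mathbb{A}$, every map $\alpha:X\to A$ extends to an endomorphism of $\mathbb{A}$. A semilattice is a commutative semigroup all of whose elements are idempotent; a subsemilattice of a monoid is a subsemigroup that is a semilattice. *)

(* Defs.v *)
From mathcomp Require Export all_boot.
From mathcomp Require Export boolp classical_sets functions cardinality.

Set Implicit Arguments.
Unset Strict Implicit.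
Unset Printing Implicit Defensive.

Local Open Scope classical_set_scope.
Local Open Scope card_scope.

Definition op (A : Type) (k : nat) : Type := ('I_k -> A) -> A.

(* Nullary operations are the operations of arity 0: the type ['I_0 -> A] has
   exactly one inhabitant. *)
Definition signature_ops (A : Type) : Type := forall k : nat, set (op A k).

Definition is_endo (A : Type) (F : signature_ops A) (h : A -> A) : Prop :=
  forall (k : nat) (f : op A k), F k f ->
  forall a : 'I_k -> A, h (f a) = f (h \o a).

Definition End (A : Type) (F : signature_ops A) : set (A -> A) :=
  [set h | is_endo F h].

Inductive clone (A : Type) (F : signature_ops A) :
    forall k : nat, op A k -> Prop :=
  | clone_fundamental (k : nat) (f : op A k) : F k f -> clone F f
  | clone_proj (k : nat) (i : 'I_k) : clone F (fun x : 'I_k -> A => x i)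
  | clone_comp (k m : nat) (f : op A k) (g : 'I_k -> op A m) :
      clone F f -> (forall i, clone F (g i)) ->
      clone F (fun x : 'I_m -> A => f (fun i => g i x)).

Definition constant_op (A : Type) (k : nat) (f : op A k) : Prop :=
  exists a : A, forall x : 'I_k -> A, f x = a.

Definition clone_has_constants (A : Type) (F : signature_ops A) : Prop :=
  exists (k : nat) (f : op A k), clone F f /\ constant_op f.

Definition closed_under (A : Type) (F : signature_ops A) (B : set A) : Prop :=
  forall (k : nat) (f : op A k), F k f ->
  forall a : 'I_k -> A, (forall i, B (a i)) -> B (f a).

(* The empty set counts as closed when there are no nullary operations, so that
   [gen F set0] is as in [gen_set0_noCon] and [gen_set0_Con] below. *)
Definition gen (A : Type) (F : signature_ops A) (X : set A) : set A :=
  smallest (closed_under F) X.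

Definition Con (A : Type) (F : signature_ops A) : set A :=
  [set c | exists2 f : op A 0, F 0 f & forall x, f x = c].

Lemma closed_under_Con (A : Type) (F : signature_ops A) (B : set A) :
  closed_under F B -> Con F `<=` B.
Proof.
move=> cB c [f Ff fc]; rewrite -(fc (fun i : 'I_0 => False_rect A (notF (valP i)))).
by apply: cB => // -[].
Qed.

Lemma gen_set0_Con (A : Type) (F : signature_ops A) :
  gen F set0 = gen F (Con F).
Proof.
apply/seteqP; split=> x gx B [cB sB]; apply: gx; split=> //.
exact: closed_under_Con.
Qed.

Lemma gen_set0_noCon (A : Type) (F : signature_ops A) :
  Con F = set0 -> gen F set0 = set0.
Proof.
move=> C0; apply/seteqP; split=> // x; apply; split=> // -[|k] f Ff a.
  move=> _; have : Con F (f a).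
    by exists f => // y; congr f; apply/funext => -[].
  by rewrite C0.
by move=> /(_ ord0).
Qed.

Definition independent (A : Type) (F : signature_ops A) (X : set A) : Prop :=
  forall x, X x -> ~ gen F (X `\ x) x.

Definition exchange (A : Type) (F : signature_ops A) : Prop :=
  forall (X : set A) (x y : A),
    gen F (X `|` [set y]) x -> ~ gen F X x -> gen F (X `|` [set x]) y.

Definition basis (A : Type) (F : signature_ops A) (X : set A) : Prop :=
  independent F X /\ gen F X = setT.

Definition has_dimension (A : Type) (F : signature_ops A) (n : nat) : Prop :=
  exists2 X : set A, basis F X & X #= `I_n.

Definition independence_algebra (A : Type) (F : signature_ops A) : Prop :=
  exchange F /\
  forall X : set A, basis F X -> forall h : X -> A,
    exists2 e : A -> A, End F e & forall x : X, e (val x) = h x.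

Definition subsemilattice (T : Type) (M S : set (T -> T)) : Prop :=
  [/\ S `<=` M,
      forall e f, S e -> S f -> S (e \o f),
      forall e f, S e -> S f -> e \o f = f \o e
    & forall e, S e -> e \o e = e].

Definition largest_subsemilattice (T : Type) (M S : set (T -> T)) : Prop :=
  subsemilattice M S /\
  forall S' : set (T -> T), subsemilattice M S' -> S' #<= S.

(* Main.v *)
Require Import Defs.

Local Open Scope classical_set_scope.
Local Open Scope card_scope.

(** Let [E] be a subsemilattice fixing an independent set [B] pointwise, where
    [d] further elements generate the algebra over [B]; then [E] has at most
    [2 ^ d] elements, by induction on [d].  If [E] has two elements, there are
    [x] outside [gen F B] and [c] such that every [f] in [E] satisfies
    [f x = x], or [f x = c] with [c] in [gen F B].  The maps of the first kind
    fix [B `|` [set x]]; those of the second kind become maps fixing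
    [B `|` [set x]] after composing with the projection sending [x] to [c] and
    resetting the value at [x] to [x].  Both halves thus have at most
    [2 ^ d.-1] elements.  If [gen F set0] is empty, the second kind cannot occur
    for [B = set0], which saves a factor 2.  The bounds are attained by the maps
    that fix part of a basis and collapse the rest to one point, either in
    [gen F set0] or in the basis.  Finally, the clone contains constants iff
    [gen F set0] is nonempty: otherwise, by exchange, a constant would be a
    one-element basis fixed by all endomorphisms, so [A] would be trivial. *)

(** * Generated subalgebras, and the dimension of the algebra over a subset *)

Section Generation.

Set Implicit Arguments.
Unset Strict Implicit.

Context {A : Type} {F : signature_ops A}.
Implicit Types (X Y B : set A) (x y z : A) (h : A -> A).

Lemma gen_closed X : closed_under F (gen F X).
Proof.
move=> k f Ff a ga B cB; apply: cB.1 => // i.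
exact: ga i B cB.
Qed.

Lemma sub_gen X : X `<=` gen F X.
Proof. exact: sub_gen_smallest. Qed.

Lemma gen_min X B : closed_under F B -> X `<=` B -> gen F X `<=` B.
Proof. exact: smallest_sub. Qed.

Lemma gen_sub X Y : X `<=` gen F Y -> gen F X `<=` gen F Y.
Proof. by apply: gen_min; exact: gen_closed. Qed.

Lemma gen_mono X Y : X `<=` Y -> gen F X `<=` gen F Y.
Proof. by move=> XY; apply: gen_sub => x /XY/sub_gen. Qed.

Lemma gen_eq_endo X h1 h2 : End F h1 -> End F h2 ->
  (forall x, X x -> h1 x = h2 x) -> forall x, gen F X x -> h1 x = h2 x.
Proof.
move=> E1 E2 eqX; apply: (@gen_min X [set x | h1 x = h2 x]) => // k f Ff a e.
rewrite /= (E1 k f Ff) (E2 k f Ff); congr f; apply/funext => i; exact: e.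
Qed.

Lemma gen_fix_endo X h : End F h -> (forall x, X x -> h x = x) ->
  forall x, gen F X x -> h x = x.
Proof. by move=> Eh; apply: gen_eq_endo. Qed.

Lemma gen_range h : End F h -> gen F (range h) `<=` range h.
Proof.
move=> Eh; apply: gen_min => // k f Ff a ra.
have /choice[b bP] : forall i, exists b, h b = a i.
  by move=> i; have [b _ <-] := ra i; exists b.
by exists (f b) => //; rewrite (Eh k f Ff); congr f; apply/funext.
Qed.

Lemma End_comp h1 h2 : End F h1 -> End F h2 -> End F (h1 \o h2).
Proof. by move=> E1 E2 k f Ff a /=; rewrite (E2 k f Ff) (E1 k f Ff). Qed.

(** The upper bound [d] on the dimension over [B], in recursive form so that inductions can enlarge
    [B]. The added elements may be redundant. *)
Fixpoint spans d B : Prop :=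
  if d is d'.+1 then exists y, spans d' (B `|` [set y]) else gen F B = setT.

(** The matching lower bound: here each added element must be new. Applied to the range of an
    endomorphism, it measures how small that range is. *)
Fixpoint free_chain d B : Prop :=
  if d is d'.+1 then exists2 y, ~ gen F B y & free_chain d' (B `|` [set y])
  else True.

Lemma genU_sub B B' y :
  B `<=` gen F B' -> B `|` [set y] `<=` gen F (B' `|` [set y]).
Proof.
move=> sB x [/sB|->]; last by apply: sub_gen; right.
by apply: gen_mono => z; left.
Qed.

Lemma spans_mono d B B' : B `<=` gen F B' -> spans d B -> spans d B'.
Proof.
elim: d B B' => [|d IH] B B' sB /=.
  by move=> gT; apply/seteqP; split=> // x _; apply: (gen_sub sB); rewrite gT.
by move=> [y Hy]; exists y; apply: IH Hy; apply: genU_sub.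
Qed.

Lemma spans_image d B (g : nat -> A) :
  gen F (B `|` g @` `I_d) = setT -> spans d B.
Proof.
elim: d B => [|d IH] B gT; first by rewrite /= -gT II0 image_set0 setU0.
exists (g d); apply: IH; apply/seteqP; split=> // x _.
have : gen F (B `|` g @` `I_d.+1) x by rewrite gT.
apply: gen_mono => y [By|[i ltid <-]]; first by left; left.
move: ltid => /=; rewrite ltnS leq_eqVlt => /orP[/eqP->|ltid].
  by left; right.
by right; exists i.
Qed.

Lemma free_chain_anti d B B' :
  B' `<=` gen F B -> free_chain d B -> free_chain d B'.
Proof.
elim: d B B' => [//|d IH] B B' sB /= [y By Hy]; exists y.
  by move/(gen_sub sB).
by apply: IH Hy; apply: genU_sub.
Qed.

Lemma clone_endo k (f : op A k) h : End F h -> clone F f ->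
  forall a, h (f a) = f (h \o a).
Proof.
move=> Eh; elim=> {k f} [k f Ff|k i|k m f g _ IHf _ IHg] a //.
  exact: Eh.
by rewrite IHf; congr f; apply/funext => i /=; rewrite IHg.
Qed.

Lemma clone_gen k (f : op A k) B : clone F f ->
  forall a, (forall i, gen F B (a i)) -> gen F B (f a).
Proof.
elim=> {k f} [k f Ff|k i|k m f g _ IHf _ IHg] a //.
  exact: gen_closed.
by move=> Ba; apply: IHf => i; apply: IHg.
Qed.

End Generation.

(** * Consequences of exchange, and the pivot element of a semilattice *)

Section Exchange.

Set Implicit Arguments.
Unset Strict Implicit.

Context {A : Type} {F : signature_ops A} (exF : exchange F).
Implicit Types (X Y B : set A) (x y z : A).

(** Steinitz replacement: [x] takes the place of the first [y] that brings it into the generated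
    subalgebra, since exchange then recovers [y] from [x]. *)
Lemma spans_exchange d B x : spans (F := F) d B -> ~ gen F B x ->
  exists2 d', d = d'.+1 & spans (F := F) d' (B `|` [set x]).
Proof.
elim: d B => [|d IH] B /=; first by move=> -> [].
move=> [y Hy] Bx; have [gx|ngx] := pselect (gen F (B `|` [set y]) x).
  exists d => //; apply: spans_mono Hy => z [Bz|->]; last exact: exF gx Bx.
  by apply: sub_gen; left.
have [d' -> Hd'] := IH _ Hy ngx; exists d'.+1 => //=; exists y.
by rewrite setUAC.
Qed.

Lemma free_chain_leq d k B : spans (F := F) d B -> free_chain (F := F) k B ->
  (k <= d)%N.
Proof.
elim: k d B => [//|k IH] d B sB /= [y By Hy].
by have [d' -> sd'] := spans_exchange sB By; apply: IH Hy.
Qed.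

(** If some [x] in [B] depended on [y] and the rest of [B], exchange would put [y] in [gen F B]. *)
Lemma independentU1 B y :
  independent F B -> ~ gen F B y -> independent F (B `|` [set y]).
Proof.
move=> iB By x [Bx|->]; last first.
  by move=> g; apply: By; apply: gen_mono g => z [[//|->] /(_ erefl)].
move=> gx; apply: By.
have xy : (B `|` [set y]) `\ x `<=` B `\ x `|` [set y].
  by move=> z [[Bz|->] zx]; [left|right].
have := exF (gen_mono xy gx) (iB x Bx).
by apply: gen_mono => z [[]|->].
Qed.

Lemma basis_extension d B : independent F B -> spans (F := F) d B ->
  exists2 X, basis F X & B `<=` X.
Proof.
elim: d B => [|d IH] B iB /=; first by move=> gB; exists B.
move=> [y Hy]; have [By|By] := pselect (gen F B y).
  apply: IH => //; apply: spans_mono Hy => z [Bz|-> //]; exact: sub_gen.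
have [X bX sX] := IH _ (independentU1 iB By) Hy.
by exists X => // z Bz; apply: sX; left.
Qed.

(* Every endomorphism of [E] pushes the range of [e] to a range that is either
   inside [gen F B] or, [e] having a minimal range among those not inside
   [gen F B], equal to that of [e].  So any [x] in the range of [e] but not in
   [gen F B] works. *)
Lemma semilattice_pivot n (E : set (A -> A)) B :
  spans (F := F) n set0 -> subsemilattice (End F) E ->
  (forall f b, E f -> B b -> f b = b) ->
  (forall f g, E f -> E g -> f = g) \/
  exists2 x, ~ gen F B x & exists c, forall f, E f ->
    f x = x \/ f x = c /\ gen F B c.
Proof.
move=> sn [EE Ecomp Ecom Eid] EB.
have EgB f b : E f -> gen F B b -> f b = b.
  by move=> Ef; apply: (gen_fix_endo (EE _ Ef)) => x; apply: EB.
have idE f u : E f -> f (f u) = f u.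
  by move=> Ef; apply: (congr1 (@^~ u) (Eid f Ef)).
have comE f g u : E f -> E g -> f (g u) = g (f u).
  by move=> Ef Eg; apply: (congr1 (@^~ u) (Ecom f g Ef Eg)).
have [allB|/existsNP[f0 /not_implyP[Ef0 Bf0]]] :=
    pselect (forall f, E f -> range f `<=` gen F B).
  (* All values lie in [gen F B], which [E] fixes, so [f u = g (f u) = f (g u) = g u]. *)
  left=> f g Ef Eg; apply/funext => u.
  have Bf : gen F B (f u) by apply: (allB f Ef); exists u.
  have Bg : gen F B (g u) by apply: (allB g Eg); exists u.
  by rewrite -(EgB g _ Eg Bf) comE // EgB.
right.
(* A maximal [k] stands for a minimal range; the dimension [n] bounds it. *)
pose P k := `[< exists2 e, E e /\ ~ (range e `<=` gen F B) &
                          free_chain (F := F) k (range e) >].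
have exP : exists k, P k by exists 0; apply/asboolP; exists f0.
have leP k : P k -> (k <= n)%N.
  move=> /asboolP[e _]; apply: free_chain_leq.
  exact: spans_mono sn.
have [k /asboolP[e [Ee Be] ck] kmax] := ex_maxnP exP leP.
have mine f : E f -> ~ (range (f \o e) `<=` gen F B) -> f \o e = e.
  move=> Ef nfe; have Efe := Ecomp _ _ Ef Ee.
  have [sub|/existsNP[z /not_implyP[ez nz]]] :=
      pselect (range e `<=` range (f \o e)).
    apply/funext => u; have [v _ fev] : range (f \o e) (e u).
      by apply: sub; exists u.
    by rewrite -fev -(idE _ v Efe) fev /= idE.
  (* Since [f] and [e] commute, the range of [f \o e] lies in that of [e]; a point [z] lost on the
     way lengthens the chain. *)
  suff /kmax : P k.+1 by rewrite ltnn.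
  apply/asboolP; exists (f \o e) => //=; exists z.
    by move=> /(gen_range (EE _ Efe)).
  apply: free_chain_anti ck => y [[v _ <-]|->]; apply: sub_gen => //.
  by exists (f v) => //; rewrite comE.
have [x /not_implyP[ex nBx]] : exists x, ~ (range e x -> gen F B x).
  exact/existsNP.
have eex : e x = x.
  by case: ex => v _ <-; rewrite idE.
have dich f : E f -> f x <> x -> range (f \o e) `<=` gen F B.
  move=> Ef fx; apply: contrapT => /(mine f Ef) fe; apply: fx.
  by rewrite -{1}eex -[LHS]/((f \o e) x) fe.
exists x => //.
(* If all of [E] fixes [x], any [c] will do. Otherwise [c] is the image of [x] under some [g] moving
   it; commutation makes it the same for all such maps. *)
have [allx|/existsNP[g /not_implyP[Eg gx]]] :=
    pselect (forall f, E f -> f x = x).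
  by exists x => f /allx; left.
have Bg : gen F B (g x).
  by apply: (dich g Eg gx); exists x => //=; rewrite eex.
exists (g x) => f Ef; have [fx|fx] := pselect (f x = x); [by left|right].
have Bf : gen F B (f x).
  by apply: (dich f Ef fx); exists x => //=; rewrite eex.
split=> //.
by rewrite -(EgB g _ Eg Bf) comE // EgB.
Qed.

End Exchange.

(** * Finite cardinality bounds through numberings *)

Lemma card_le_IIP (T : Type) (S : set T) (N : nat) :
  S #<= `I_N <-> exists phi : T -> nat, (forall s, S s -> (phi s < N)%N) /\
    (forall s t, S s -> S t -> phi s = phi t -> s = t).
Proof.
split=> [/pcard_leP[phi]|[phi [ltN inj]]].
  exists phi; split=> [s Ss|s t Ss St]; first exact: (@funS _ _ _ _ phi s Ss).
  exact: (@inj _ _ _ phi s t (mem_set Ss) (mem_set St)).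
have inS : {in S &, injective phi}.
  by move=> s t /set_mem Ss /set_mem St; exact: inj.
rewrite -(card_le_eql (inj_card_eq inS)); apply: subset_card_le => _ [s Ss <-].
exact: ltN.
Qed.

Lemma card_leU_II (T : Type) (S1 S2 : set T) (N1 N2 : nat) :
  S1 #<= `I_N1 -> S2 #<= `I_N2 -> S1 `|` S2 #<= `I_(N1 + N2).
Proof.
move=> /card_le_IIP[phi1 [lt1 inj1]] /card_le_IIP[phi2 [lt2 inj2]].
apply/card_le_IIP.
exists (fun s => if `[< S1 s >] then phi1 s else (N1 + phi2 s)%N); split.
  move=> s S12s; case: asboolP => [/lt1 ltN|nS1].
    by rewrite (leq_trans ltN) ?leq_addr.
  by case: S12s => // /lt2; rewrite ltn_add2l.
move=> s t S12s S12t; case: asboolP => S1s; case: asboolP => S1t.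
- exact: inj1.
- by move=> e; move: (lt1 _ S1s); rewrite e ltnNge leq_addr.
- by move=> e; move: (lt1 _ S1t); rewrite -e ltnNge leq_addr.
- by case: S12s S12t => // S2s [] // S2t /addnI; apply: inj2.
Qed.

(** * The upper bound, and semilattices attaining it *)

Section IndependenceAlgebra.

Set Implicit Arguments.
Unset Strict Implicit.

Context {A : Type} {F : signature_ops A} (hF : independence_algebra F).
Implicit Types (X B : set A) (x c : A) (E : set (A -> A)).

Let exF : exchange F := hF.1.

(** Choice makes the extension property a function; taking total maps as arguments avoids the
    subtype of [X]. *)
Lemma basis_endo X : basis F X -> exists ext : (A -> A) -> (A -> A),
  (forall h, End F (ext h)) /\ (forall h u, X u -> ext h u = h u).
Proof.
move=> bX.
have /choice[ext extP] : forall h : A -> A, exists e,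
    End F e /\ forall u, X u -> e u = h u.
  move=> h; have [e Ee eh] := hF.2 X bX (h \o val).
  by exists e; split=> // u Xu; exact: (eh (exist _ u (mem_set Xu))).
by exists ext; split=> h; have [] := extP h.
Qed.

Lemma basis_eq_endo X f g : basis F X -> End F f -> End F g ->
  (forall u, X u -> f u = g u) -> f = g.
Proof.
move=> [_ gX] Ef Eg fg; apply/funext => u.
by apply: (gen_eq_endo Ef Eg fg); rewrite gX.
Qed.

(* For projections of a vector space, [Phi f] is [f] plus the projection onto
   the line of [x]. *)
Lemma semilattice_shift X B x c E :
  basis F X -> B `<=` X -> X x -> ~ gen F B x -> gen F B c ->
  subsemilattice (End F) E -> (forall f b, E f -> B b -> f b = b) ->
  (forall f, E f -> f x = c) ->
  exists Phi : (A -> A) -> (A -> A),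
    [/\ subsemilattice (End F) (Phi @` E),
        forall f b, E f -> (B `|` [set x]) b -> Phi f b = b &
        forall f g, E f -> E g -> Phi f = Phi g -> f = g].
Proof.
move=> bX BX Xx Bx Bc [EE Ecomp Ecom Eid] EB Ex.
have [ext [extE extX]] := basis_endo bX.
have Ec f : E f -> f c = c.
  by move=> Ef; apply: gen_fix_endo Bc; [exact: EE|move=> b; exact: EB].
pose p := ext (fun u => if `[< u = x >] then c else u).
have px : p x = c by rewrite /p extX //; case: asboolP.
have pX u : X u -> u <> x -> p u = u.
  by move=> Xu ux; rewrite /p extX //; case: asboolP.
have Bnx b : B b -> b <> x.
  by move=> Bb bx; apply: Bx; rewrite -bx; exact: sub_gen.
have pB b : B b -> p b = b by move=> Bb; apply: pX; [exact: BX|exact: Bnx].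
have pc : p c = c by apply: gen_fix_endo Bc => //; exact: extE.
(* It suffices to look at [x], where [f (p x) = f c = c = f x]. *)
have fp f : E f -> f \o p = f.
  move=> Ef; apply: (basis_eq_endo bX); [|exact: EE|].
    by apply: End_comp; [exact: EE|exact: extE].
  move=> u Xu /=; have [->|ux] := pselect (u = x); last by rewrite pX.
  by rewrite px Ec // Ex.
pose Phi f := ext (fun u => if `[< u = x >] then x else p (f u)).
have Phix f : Phi f x = x by rewrite /Phi extX //; case: asboolP.
have PhiX f u : X u -> u <> x -> Phi f u = p (f u).
  by move=> Xu ux; rewrite /Phi extX //; case: asboolP.
have PhiB f b : E f -> B b -> Phi f b = b.
  by move=> Ef Bb; rewrite (PhiX f b (BX b Bb) (Bnx b Bb)) (EB f b) // pB.
have Phic f : E f -> Phi f c = c.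
  by move=> Ef; apply: gen_fix_endo Bc => [|b]; [exact: extE|exact: PhiB].
(* This intertwining makes [Phi] multiplicative. *)
have Phip f : E f -> Phi f \o p = p \o f.
  move=> Ef; apply: (basis_eq_endo bX).
  - by apply: End_comp; exact: extE.
  - by apply: End_comp; [exact: extE|exact: EE].
  move=> u Xu /=; have [->|ux] := pselect (u = x); last by rewrite pX // PhiX.
  by rewrite px Phic // Ex.
have PhiM f g : E f -> E g -> Phi f \o Phi g = Phi (f \o g).
  move=> Ef Eg; apply: (basis_eq_endo bX); [|exact: extE|].
    by apply: End_comp; exact: extE.
  move=> u Xu /=; have [->|ux] := pselect (u = x); first by rewrite !Phix.
  rewrite (PhiX g u) // (PhiX (f \o g) u) //.
  by rewrite -[LHS]/((Phi f \o p) (g u)) Phip.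
exists Phi; split.
- split=> [_ [f Ef <-]|_ _ [f Ef <-] [g Eg <-]|_ _ [f Ef <-] [g Eg <-]
    |_ [f Ef <-]].
  + exact: extE.
  + by exists (f \o g); [exact: Ecomp|rewrite PhiM].
  + by rewrite !PhiM // Ecom.
  + by rewrite PhiM // Eid.
- by move=> f b Ef [Bb|->]; [exact: PhiB|exact: Phix].
- move=> f g Ef Eg fg.
  have pfg : p \o f = p \o g.
    apply: (basis_eq_endo bX).
    + by apply: End_comp; [exact: extE|exact: EE].
    + by apply: End_comp; [exact: extE|exact: EE].
    move=> u Xu /=; have [->|ux] := pselect (u = x); first by rewrite !Ex.
    by rewrite -!PhiX // fg.
  (* As [h \o p = h], [h \o k = h \o p \o k = h \o p \o h = h \o h = h]. Used both ways, with
     commutation, it gives [f = g]. *)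
  have absorb h k : E h -> E k -> p \o h = p \o k -> h \o k = h.
    by move=> Eh Ek hk; rewrite -{1}(fp h Eh) -compA -hk compA fp ?Eid.
  by rewrite -(absorb f g) // Ecom // absorb.
Qed.

Lemma subsemilattice_card_le n d B E :
  spans (F := F) n set0 -> independent F B -> spans (F := F) d B ->
  subsemilattice (End F) E -> (forall f b, E f -> B b -> f b = b) ->
  E #<= `I_(2 ^ d).
Proof.
move=> sn; elim: d B E => [|d IH] B E iB sB sE EB;
  have [Eeq|[x Bx [c xc]]] := semilattice_pivot exF sn sE EB.
- apply/card_le_IIP; exists (fun=> 0); split=> // f g Ef Eg _; exact: Eeq.
- by have [? //] := spans_exchange exF sB Bx.
- apply/card_le_IIP; exists (fun=> 0); split=> [*|f g Ef Eg _]; last exact: Eeq.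
  by rewrite expn_gt0.
have [_ [<-] sBx] := spans_exchange exF sB Bx.
have iBx := independentU1 exF iB Bx.
have [X bX BX] := basis_extension exF iBx sBx.
have [EE Ecomp Ecom Eid] := sE.
pose E1 := E `&` [set f | f x = x].
pose E0 := E `&` [set f | f x = c /\ gen F B c].
have E10 : E `<=` E1 `|` E0.
  by move=> f Ef; have [fx|fx] := xc f Ef; [left|right].
have subE1 : E1 #<= `I_(2 ^ d).
  apply: (IH (B `|` [set x])) => // [|f b [Ef fx] [Bb|->] //]; last exact: EB.
  split=> [f [/EE]//|f g [Ef fx] [Eg gx]|f g [Ef _] [Eg _]|f [Ef _]].
  - by split; [exact: Ecomp|rewrite /= gx].
  - exact: Ecom.
  - exact: Eid.
have subE0 : E0 #<= `I_(2 ^ d).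
  (* Without [gen F B c] the set [E0] is empty. *)
  have [Bc|Bc] := pselect (gen F B c); last first.
    apply/card_le_IIP; exists (fun=> 0).
    by split=> [f [_ [_ /Bc]]|f g [_ [_ /Bc]]].
  have sE0 : subsemilattice (End F) E0.
    split=> [f [/EE]//|f g [Ef [fx _]] [Eg [gx _]]|f g [Ef _] [Eg _]|f [Ef _]].
    - split; [exact: Ecomp|split=> //=].
      rewrite gx; apply: gen_fix_endo Bc => [|b Bb]; [exact: EE|exact: EB].
    - exact: Ecom.
    - exact: Eid.
  have [Phi [sPhi Phifix Phiinj]] : exists Phi : (A -> A) -> (A -> A),
      [/\ subsemilattice (End F) (Phi @` E0),
          forall f b, E0 f -> (B `|` [set x]) b -> Phi f b = b &
          forall f g, E0 f -> E0 g -> Phi f = Phi g -> f = g].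
    apply: (semilattice_shift bX _ _ Bx Bc sE0).
    - by move=> b Bb; apply: BX; left.
    - by apply: BX; right.
    - by move=> f b [Ef _]; exact: EB.
    - by move=> f [_ []].
  have inj : {in E0 &, injective Phi}.
    by move=> f g /set_mem E0f /set_mem E0g; exact: Phiinj.
  rewrite -(card_le_eql (inj_card_eq inj)); apply: (IH (B `|` [set x])) => //.
  by move=> _ b [f E0f <-]; exact: Phifix.
apply: card_le_trans (subset_card_le E10) _.
by rewrite expnS mul2n -addnn; exact: card_leU_II.
Qed.

(** A subset [I] of the indices gives the map [e I] that fixes the [g i] with [i] in [I] and sends
    the rest of the basis to [c]. Because [c] is fixed, composition is intersection of subsets;
    because no [g i] is [c], [I] can be read off from [e I]. *)
Lemma coordinate_subsemilattice X m (g : 'I_m -> A) c :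
  basis F X -> injective g -> (forall i, X (g i)) -> (forall i, g i <> c) ->
  X c \/ gen F set0 c ->
  exists E, subsemilattice (End F) E /\ E #= `I_(2 ^ m).
Proof.
move=> bX g_inj Xg gc Xc; have [ext [extE extX]] := basis_endo bX.
pose keep (I : {set 'I_m}) u := `[< exists2 i, i \in I & g i = u >].
pose e I := ext (fun u => if keep I u then u else c).
have keepc I : keep I c = false by apply/asboolPn => -[i _ /gc].
have eX I u : X u -> e I u = if keep I u then u else c.
  by move=> Xu; rewrite /e extX.
have ec I : e I c = c.
  case: Xc => [Xc|gen0c]; first by rewrite eX // keepc.
  by apply: gen_fix_endo gen0c => //; exact: extE.
have keepI I J u : keep (I :&: J) u = keep I u && keep J u.
  apply/asboolP/andP => [[i]|[/asboolP[i Ii <-] /asboolP[j Jj /g_inj ij]]].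
    by rewrite inE => /andP[Ii Ji] <-; split; apply/asboolP; exists i.
  by exists i; rewrite // inE Ii -ij.
have eM I J : e I \o e J = e (I :&: J).
  apply: (basis_eq_endo bX); [|exact: extE|].
    by apply: End_comp; exact: extE.
  move=> u Xu /=; rewrite [in RHS]eX // keepI (eX J) //.
  by case: (keep J u); rewrite ?andbT ?andbF; [exact: eX|exact: ec].
have e_inj : injective e.
  move=> I J eIJ; apply/setP => i.
  have keepg (K : {set 'I_m}) : keep K (g i) = (i \in K).
    by apply/asboolP/idP => [[j Kj /g_inj<-]|] //; exists i.
  move: (congr1 (@^~ (g i)) eIJ); rewrite /= !eX // !keepg.
  by case: (i \in I) (i \in J) => -[] // => [|/esym] /gc.
exists (range e); split.
  split=> [_ [I _ <-]|_ _ [I _ <-] [J _ <-]|_ _ [I _ <-] [J _ <-]|_ [I _ <-]].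
  - exact: extE.
  - by rewrite eM; exists (I :&: J)%SET.
  - by rewrite !eM finset.setIC.
  - by rewrite eM finset.setIid.
apply: card_eq_trans (inj_card_eq (in2W e_inj)) _.
have card2m : #|{set 'I_m}| = 2 ^ m.
  by rewrite -cardsT -powersetT card_powerset cardsT card_ord.
have rk : range (fun I : {set 'I_m} => nat_of_ord (enum_rank I)) = `I_(2 ^ m).
  apply/seteqP; split=> [_ [I _ <-]|k /=]; first by rewrite /= -card2m.
  rewrite -card2m => km; exists (enum_val (Ordinal km)) => //.
  by rewrite enum_valK.
rewrite -rk card_eq_sym; apply: inj_card_eq.
by move=> I J _ _ /val_inj /enum_rank_inj.
Qed.

End IndependenceAlgebra.

(** * The maximum size and its dependence on constants *)

Theorem theorem1p1 (A : Type) (F : signature_ops A) (n : nat)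
    (hF : independence_algebra F) (hn : has_dimension F n)
    (hA : exists a b : A, a <> b) :
  (exists S, largest_subsemilattice (End F) S) /\
  (forall S, largest_subsemilattice (End F) S ->
     ((0 < n)%N /\ S #= `I_(2 ^ n.-1) \/ S #= `I_(2 ^ n)) /\
     (S #= `I_(2 ^ n) <-> clone_has_constants F)).
Proof.
have [X bX Xn] := hn; have [a0 [b0 ab0]] := hA; have exF := hF.1.
(* [g] enumerates the basis [X] on indices below [n]; beyond, its values are arbitrary. *)
have [g [gX ginj gsurj]] : exists g : nat -> A,
    [/\ forall i, (i < n)%N -> X (g i),
        forall i j, (i < n)%N -> (j < n)%N -> g i = g j -> i = j &
        forall u, X u -> exists2 i, (i < n)%N & g i = u].
  have /card_set_bijP[phi [phiX phi_inj phi_surj]] := Xn.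
  have /choice[g gP] : forall i, exists u, (i < n)%N -> X u /\ phi u = i.
    move=> i; have [/phi_surj[u Xu <-]|_] := boolP (i < n)%N; last by exists a0.
    by exists u.
  exists g; split=> [i /gP[]//|i j /gP[_ pi] /gP[_ pj] gij|u Xu].
    by rewrite -pi gij.
  exists (phi u); first exact: phiX.
  have [Xg pg] := gP _ (phiX u Xu).
  by apply: phi_inj; rewrite ?inE.
have sn : spans (F := F) n set0.
  apply: (spans_image (g := g)); apply/seteqP; split=> // y _.
  rewrite set0U; have := bX.2; rewrite -subTset.
  move=> /(_ y I); apply: gen_mono => u /gsurj[i ltin <-].
  by exists i.
(* It suffices to find an exponent [m] whose bound [2 ^ m] is attained: all largest subsemilattices
   then have that size, and the size determines [m]. *)
suff [m mP [E [sE cE]]] : exists2 m,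
    [/\ (0 < n)%N /\ m = n.-1 \/ m = n, m = n <-> clone_has_constants F &
        forall S, subsemilattice (End F) S -> S #<= `I_(2 ^ m)] &
    exists S, subsemilattice (End F) S /\ S #= `I_(2 ^ m).
  have [mn mclone maxm] := mP.
  split; first by exists E; split=> // S /maxm; rewrite (card_le_eqr cE).
  move=> S [sS Smax].
  have cS : S #= `I_(2 ^ m).
    apply: Cantor_Bernstein; first exact: maxm.
    by rewrite -(card_le_eql cE); exact: Smax.
  split.
    by case: mn => [[n0 mn]|mn]; [left; rewrite -mn|right; rewrite -mn].
  rewrite -mclone; split=> [Sn|<- //].
  have : `I_(2 ^ m) #= `I_(2 ^ n).
    by apply: card_eq_trans Sn; rewrite card_eq_sym.
  rewrite card_eq_le !card_le_II !leq_exp2l // -eqn_leq.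
  by move/eqP.
have [[c c0]|gen0] := pselect (exists c, gen F set0 c).
  exists n; first split.
  - by right.
  - split=> // _.
    have [f Ff] : exists f : op A 0, F 0 f.
      apply: contrapT => nf; have : gen F set0 = set0.
        apply: gen_set0_noCon; apply/seteqP; split=> // z.
        by case=> f Ff _; case: nf; exists f.
      by move=> e; move: c0; rewrite e.
    exists 0, f; split; first exact: clone_fundamental.
    exists (f (fun i => c)) => x; congr f; apply/funext => -[].
    by [].
  - move=> S sS; apply: (subsemilattice_card_le hF sn _ sn sS) => //.
  apply: (coordinate_subsemilattice hF bX (g := fun i : 'I_n => g i) (c := c)).
  - by move=> i j /(ginj _ _ (ltn_ord i) (ltn_ord j))/val_inj.
  - by move=> i; apply: gX.
  - move=> i gc; apply: (bX.1 (g i) (gX _ (ltn_ord i))).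
    by rewrite gc; apply: gen_mono c0.
  - by right.
(* In dimension 0, [gen F set0] would be everything, hence nonempty. *)
have [k nk] : exists k, n = k.+1.
  case: (n) sn => [|k _]; last by exists k.
  by move=> /= gT; case: gen0; exists a0; rewrite gT.
subst n.
have nclone : ~ clone_has_constants F.
  move=> [j [f [cf [a fa]]]].
  have fix_a h : End F h -> h a = a.
    by move=> Eh; rewrite -{1}(fa (fun=> a)) (clone_endo Eh cf) fa.
  have gena y : gen F (set0 `|` [set y]) a.
    rewrite -(fa (fun=> y)); apply: (clone_gen cf) => i.
    by apply: sub_gen; right.
  have nga : ~ gen F set0 a by move=> ga; apply: gen0; exists a.
  have bA : basis F [set a].
    split=> [x ->|]; first by move=> gx; apply: nga; apply: gen_mono gx => z [].
    apply/seteqP; split=> // y _.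
    by have := exF _ _ _ (gena y) nga; rewrite set0U.
  have [ext [extE extX]] := basis_endo hF bA.
  (* The endomorphism sending the basis element [a] to [b] also fixes [a]. *)
  have alla b : b = a by rewrite -(fix_a _ (extE (fun=> b))) extX.
  by apply: ab0; rewrite (alla a0) (alla b0).
exists k; first split.
- by left.
- by split=> [/n_Sn//|/nclone].
- move=> S sS.
  have i0 : independent F (@set0 A) by [].
  have fix0 f b : S f -> set0 b -> f b = b by [].
  have [allS|[x x0 [c xc]]] := semilattice_pivot exF sn sS fix0.
    apply/card_le_IIP; exists (fun=> 0); split=> [*|f h Sf Sh _].
      by rewrite expn_gt0.
    exact: allS.
  (* All of [S] fixes the pivot [x], so the general bound applies over [set0]|[[set x]], with only
     [k] dimensions left. *)
  have [_ [<-] sx] := spans_exchange exF sn x0.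
  apply: (subsemilattice_card_le hF sn (independentU1 exF i0 x0) sx sS).
  move=> f b Sf [//|->]; have [//|[_ c0]] := xc f Sf.
  by case: gen0; exists c.
(* The last basis element serves as the collapse point, leaving [k] free coordinates. *)
apply: (coordinate_subsemilattice hF bX (g := fun i : 'I_k => g i) (c := g k)).
- move=> i j gij; apply/val_inj/(ginj _ _ _ _ gij); exact: ltnW (ltn_ord _).
- by move=> i; apply/gX/ltnW/ltn_ord.
- move=> i /ginj gik; have := ltn_ord i; rewrite gik ?ltnn //.
  exact: ltnW (ltn_ord _).
- by left; apply: gX.
Qed.
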